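(* Let $\mathbb{F}$ be a field of characteristic $2$, let $((\mathfrak{g},[2]),\mathscr{D})$ be a ResLieDer pair over $\mathbb{F}$ and $(V,\rho,\eta_V)$ a restricted representation of it. Then the maps $\vartheta^n:C^n_{\mathrm{ResLD}}(\mathfrak{g};V)\to C^{n+1}_{\mathrm{ResLD}}(\mathfrak{g};V)$, $n\ge1$, are coboundary operators, i.e. $\vartheta^{n+1}\circ\vartheta^n=0$ for all $n\ge1$.
   Context: Over a field $\mathbb{F}$ of characteristic $2$: a restricted Lie algebra $(\mathfrak{g},[2])$ is a Lie algebra with a map $x\mapsto x^{[2]}$ such that $[x^{[2]},y]_{\mathfrak{g}}=[x,[x,y]_{\mathfrak{g}}]_{\mathfrak{g}}$, $(ax)^{[2]}=a^2x^{[2]}$, $(x+y)^{[2]}=x^{[2]}+y^{[2]}+[x,y]_{\mathfrak{g}}$. A ResLieDer pair $((\mathfrak{g},[2]),\mathscr{D})$ is a restricted Lie algebra with a linear derivation $\mathscr{D}$ satisfying $\mathscr{D}(x^{[2]})=[x,\mathscr{D}(x)]_{\mathfrak{g}}$. A restricted representation $(V,\rho,\eta_V)$ is a vector space $V$, $\eta_V\in\mathfrak{gl}(V)$, and a Lie algebra morphism $\rho:\mathfrak{g}\to\mathfrak{gl}(V)$ with $\rho(x^{[2]})=\rho(x)^2$ and $\eta_V\circ\rho(x)=\rho(\mathscr{D}(x))+\rho(x)\circ\eta_V$. Cochains. $C^1_{*2}(\mathfrak{g};V)=\mathrm{Hom}(\mathfrak{g};V)$ (linear maps). $C^2_{*2}(\mathfrak{g};V)$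 is the set of pairs $(\varphi_2,\omega_2)$ with $\varphi_2:\wedge^2\mathfrak{g}\to V$ alternating bilinear and $\omega_2:\mathfrak{g}\to V$ with $\omega_2(ax)=a^2\omega_2(x)$, $\omega_2(x+y)=\omega_2(x)+\omega_2(y)+\varphi_2(x,y)$. For $n\ge3$, $C^n_{*2}(\mathfrak{g};V)$ is the set of pairs $(\varphi_n,\omega_n)$ with $\varphi_n:\wedge^n\mathfrak{g}\to V$ alternating $n$-linear and $\omega_n:\mathfrak{g}\times\wedge^{n-2}\mathfrak{g}\to V$, $(x,z_2,\dots,z_{n-1})\mapsto\omega_n(x,z_2,\dots,z_{n-1})$, alternating multilinear in $z_2,\dots,z_{n-1}$, with $\omega_n(ax,z_2,\dots)=a^2\omega_n(x,z_2,\dots)$ and $\omega_n(x+y,z_2,\dots,z_{n-1})=\omega_n(x,z_2,\dots,z_{n-1})+\omega_n(y,z_2,\dots,z_{n-1})+\varphi_n(x,y,z_2,\dots,z_{n-1})$. Operators $d$. For $\varphi_1\in C^1_{*2}$: $d^1\varphi_1(x,y)=\varphi_1([x,y]_{\mathfrak{g}})+\rho(x)(\varphi_1(y))+\rho(y)(\varphi_1(x))$, $\omega_{\varphi_1}(x)=\varphi_1(x^{[2]})+\rho(x)(\varphi_1(x))$. For $n\ge2$ and $(\varphi_n,\omega_n)\in C^n_{*2}$: $$d^n\varphi_n(z_1,\dots,z_{n+1})=\sum_{i}\rho(z_i)(\varphi_n(z_1,\dots,\hat z_i,\dots,z_{n+1}))+\sum_{i<j}\varphi_n([z_i,z_j]_{\mathfrak{g}},z_1,\dots,\hat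 z_i,\dots,\hat z_j,\dots,z_{n+1}),$$ $$\begin{aligned}d^n\omega_n(x,z_1,\dots,z_{n-1})=\ &\rho(x)(\varphi_n(x,z_1,\dots,z_{n-1}))+\varphi_n(x^{[2]},z_1,\dots,z_{n-1})\\&+\sum_{i}\varphi_n([x,z_i]_{\mathfrak{g}},x,z_1,\dots,\hat z_i,\dots,z_{n-1})+\sum_{i}\rho(z_i)(\omega_n(x,z_1,\dots,\hat z_i,\dots,z_{n-1}))\\&+\sum_{i<j}\omega_n(x,[z_i,z_j]_{\mathfrak{g}},z_1,\dots,\hat z_i,\dots,\hat z_j,\dots,z_{n-1}).\end{aligned}$$ Operator $\delta$. For $n=1$: $(\delta\varphi_1)(x)=\eta_V(\varphi_1(x))+\varphi_1(\mathscr{D}(x))$. For $n\ge2$: $$(\delta\varphi_n)(z_1,\dots,z_n)=\eta_V(\varphi_n(z_1,\dots,z_n))+\sum_{i=1}^n\varphi_n(z_1,\dots,\mathscr{D}(z_i),\dots,z_n),$$ $$(\delta\omega_n)(x,z_2,\dots,z_{n-1})=\eta_V(\omega_n(x,z_2,\dots,z_{n-1}))+\sum_{i=2}^{n-1}\omega_n(x,z_2,\dots,\mathscr{D}(z_i),\dots,z_{n-1})+\varphi_n(x,\mathscr{D}(x),z_2,\dots,z_{n-1})$$ (for $n=2$: $(\delta\omega_2)(x)=\eta_V(\omega_2(x))+\varphi_2(x,\mathscr{D}(x))$). The complex. $C^1_{\mathrm{ResLD}}(\mathfrak{g};V)=\mathrm{Hom}(\mathfrak{g};V)$ and $C^n_{\mathrm{ResLD}}(\mathfrak{g};V)=C^n_{*2}(\mathfrak{g};V)\times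 C^{n-1}_{*2}(\mathfrak{g};V)$ for $n\ge2$. The maps are $\vartheta^1\varphi_1=((d^1\varphi_1,\omega_{\varphi_1}),\delta\varphi_1)$; $\vartheta^2((\varphi_2,\omega_2),\varphi_1)=((d^2\varphi_2,d^2\omega_2),(d^1\varphi_1+\delta\varphi_2,\ \omega_{\varphi_1}+\delta\omega_2))$; and for $n\ge3$, $\vartheta^n((\varphi_n,\omega_n),(\varphi_{n-1},\omega_{n-1}))=((d^n\varphi_n,d^n\omega_n),(d^{n-1}\varphi_{n-1}+\delta\varphi_n,\ d^{n-1}\omega_{n-1}+\delta\omega_n))$. *)

(* Defs.v *)
From mathcomp Require Import all_boot all_order all_algebra.
(* mathcomp.classical provides the pointwise vector-space structure on the
   function type [T -> V], used below to add cochains. *)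
From mathcomp Require Import all_classical.
Set Implicit Arguments.
Unset Strict Implicit.
Unset Printing Implicit Defensive.

Import GRing.Theory.
Local Open Scope ring_scope.

(* The characteristic is not recorded in the structures below; the operators on
   cochains are written without signs and are only meant for fields with
   [2 \in [pchar F]]. *)

Record lieAlgebra (F : fieldType) (g : lmodType F) := LieAlgebra {
  bracket :> g -> g -> g;
  bracket_linear_l : forall y, linear (bracket^~ y);
  bracket_linear_r : forall x, linear (bracket x);
  bracket_alt : forall x, bracket x x = 0;
  bracket_jacobi : forall x y z,
    bracket x (bracket y z) + bracket y (bracket z x)
      + bracket z (bracket x y) = 0
}.

Record restrictedLie (F : fieldType) (g : lmodType F) := RestrictedLie {
  rlie :> lieAlgebra g;
  sq : g -> g;
  sq_bracket : forall x y, rlie (sq x) y = rlie x (rlie x y);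
  sqZ : forall a x, sq (a *: x) = a ^+ 2 *: sq x;
  sqD : forall x y, sq (x + y) = sq x + sq y + rlie x y
}.

Record resLieDer (F : fieldType) (g : lmodType F) := ResLieDer {
  rldlie :> restrictedLie g;
  der : {linear g -> g};
  der_bracket : forall x y,
    der (rldlie x y) = rldlie (der x) y + rldlie x (der y);
  der_sq : forall x, der (sq rldlie x) = rldlie x (der x)
}.

Record restrictedRep (F : fieldType) (g : lmodType F) (L : resLieDer g)
    (V : lmodType F) := RestrictedRep {
  rho :> g -> {linear V -> V};
  eta : {linear V -> V};
  rho_linear : forall v, linear (fun x => rho x v);
  rho_bracket : forall x y v,
    rho (L x y) v = rho x (rho y v) - rho y (rho x v);
  rho_sq : forall x v, rho (sq L x) v = rho x (rho x v);
  rho_der : forall x v, eta (rho x v) = rho (der L x) v + rho x (eta v)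
}.

Section Tuples.
Variable T : Type.

Definition set_arg n (z : n.-tuple T) (i : 'I_n) (y : T) : n.-tuple T :=
  [tuple if j == i then y else tnth z j | j < n].

Definition del_arg n (z : n.+1.-tuple T) (i : 'I_n.+1) : n.-tuple T :=
  [tuple tnth z (lift i j) | j < n].

(* Only used for [i < j]: then deleting entry [j] leaves entry [i] in place,
   and [inord i] is the index [i] seen in ['I_n.+1]. *)
Definition del_arg2 n (z : n.+2.-tuple T) (i j : 'I_n.+2) : n.-tuple T :=
  del_arg (del_arg z j) (inord i).

End Tuples.

Definition alt_multilinear (F : fieldType) (g V : lmodType F) n
    (f : n.-tuple g -> V) : Prop :=
  (forall z i, linear (fun y => f (set_arg z i y))) /\
  (forall z i j, i != j -> tnth z i = tnth z j -> f z = 0).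

Section Complex.
Variables (F : fieldType) (g : lmodType F) (L : resLieDer g).
Variables (V : lmodType F) (R : restrictedRep L V).

(* Degrees are shifted by one: index [k] stands for degree [k + 1], so that
   the first index [0] is the first degree of the complex.  [precochain k] is
   the space of all functions (or pairs of functions) of the appropriate shape
   and [is_cochain] cuts out the cochains in it.  In degree [n = m + 2] a pair
   [(phi, omega)] has [phi] of [n] arguments and [omega] of one distinguished
   argument followed by [n - 2 = m] others; for [m = 0] these others form the
   empty tuple, i.e. [omega] is just a function [g -> V]. *)
Definition precochain (k : nat) : lmodType F :=
  match k with
  | 0 => (g -> V : lmodType F)
  | m.+1 => ((m.+2.-tuple g -> V) * (g -> m.-tuple g -> V) : lmodType F)%type
  end.

Definition is_cochain (k : nat) : precochain k -> Prop :=
  match k with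
  | 0 => fun phi1 : g -> V => linear phi1
  | m.+1 => fun c : (m.+2.-tuple g -> V) * (g -> m.-tuple g -> V) =>
      let: (phi, omega) := c in
      [/\ alt_multilinear phi,
          forall x, alt_multilinear (omega x),
          forall a x z, omega (a *: x) z = a ^+ 2 *: omega x z
        & forall x y z, omega (x + y) z =
            omega x z + omega y z + phi [tuple of x :: y :: z]]
  end.

Definition act_sum n (f : n.-tuple g -> V) (z : n.+1.-tuple g) : V :=
  \sum_(i < n.+1) R (tnth z i) (f (del_arg z i)).

(* For [n = 0] there is no pair [i < j] and the sum is empty. *)
Definition bracket_sum n : (n.-tuple g -> V) -> n.+1.-tuple g -> V :=
  match n with
  | 0 => fun _ _ => 0
  | m.+1 => fun f z =>
      \sum_(i < m.+2) \sum_(j < m.+2 | (i < j)%N)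
        f [tuple of L (tnth z i) (tnth z j) :: del_arg2 z i j]
  end.

Definition d1_phi (phi1 : g -> V) (z : 2.-tuple g) : V :=
  let x := tnth z 0 in let y := tnth z 1 in
  phi1 (L x y) + R x (phi1 y) + R y (phi1 x).

Definition d1_omega (phi1 : g -> V) (x : g) (_ : 0.-tuple g) : V :=
  phi1 (sq L x) + R x (phi1 x).

Definition d_phi m (phi : m.+2.-tuple g -> V) (z : m.+3.-tuple g) : V :=
  act_sum phi z + bracket_sum phi z.

(* The last two sums are those of the differential of [omega x] in the
   arguments [z]. *)
Definition d_omega m (phi : m.+2.-tuple g -> V) (omega : g -> m.-tuple g -> V)
    (x : g) (z : m.+1.-tuple g) : V :=
  R x (phi [tuple of x :: z]) + phi [tuple of sq L x :: z]
  + \sum_(i < m.+1) phi [tuple of L x (tnth z i) :: x :: del_arg z i]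
  + act_sum (omega x) z + bracket_sum (omega x) z.

Definition d (k : nat) : precochain k -> precochain k.+1 :=
  match k with
  | 0 => fun phi1 => (d1_phi phi1, d1_omega phi1)
  | m.+1 => fun c => (d_phi c.1, d_omega c.1 c.2)
  end.

Definition delta1 (phi1 : g -> V) (x : g) : V :=
  eta R (phi1 x) + phi1 (der L x).

Definition delta_phi n (phi : n.-tuple g -> V) (z : n.-tuple g) : V :=
  eta R (phi z) + \sum_(i < n) phi (set_arg z i (der L (tnth z i))).

Definition delta_omega m (phi : m.+2.-tuple g -> V)
    (omega : g -> m.-tuple g -> V) (x : g) (z : m.-tuple g) : V :=
  eta R (omega x z)
  + \sum_(i < m) omega x (set_arg z i (der L (tnth z i)))
  + phi [tuple of x :: der L x :: z].

Definition delta (k : nat) : precochain k -> precochain k :=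
  match k with
  | 0 => fun phi1 => delta1 phi1
  | m.+1 => fun c => (delta_phi c.1, delta_omega c.1 c.2)
  end.

Definition precochain_ResLD (k : nat) : lmodType F :=
  match k with
  | 0 => precochain 0
  | m.+1 => (precochain m.+1 * precochain m : lmodType F)%type
  end.

Definition is_cochain_ResLD (k : nat) : precochain_ResLD k -> Prop :=
  match k with
  | 0 => fun c => @is_cochain 0 c
  | m.+1 => fun c => is_cochain c.1 /\ is_cochain c.2
  end.

Definition theta (k : nat) : precochain_ResLD k -> precochain_ResLD k.+1 :=
  match k with
  | 0 => fun phi1 => (@d 0 phi1, @delta 0 phi1)
  | m.+1 => fun c => (d c.1, d c.2 + delta c.1)
  end.

End Complex.

Arguments precochain [F] g V k.
Arguments precochain_ResLD [F] g V k.
Arguments is_cochain [F g V k] c.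
Arguments is_cochain_ResLD [F g V k] c.
Arguments d [F g L V] R [k] c.
Arguments delta [F g L V] R [k] c.
Arguments theta [F g L V] R [k] c.

(* Main.v *)
Require Import Defs.
From mathcomp Require Import all_boot all_order all_algebra.
From mathcomp Require Import all_classical.
Import GRing.Theory.
Local Open Scope ring_scope.
Set Implicit Arguments.
Unset Strict Implicit.
Unset Printing Implicit Defensive.

(** The proof is a Cartan calculus in characteristic 2. Write [i_x] for the
    insertion of [x] as first argument, [L_x] for the Lie derivative and [D] for
    the Chevalley-Eilenberg differential of alternating forms. Two forms of
    positive degree are equal as soon as all their insertions are, so identities
    are proved by induction on the degree from the commutation rules with [i_x]:
    [i_y L_x = L_x i_y + i_[x,y]] and Cartan's formula [i_x D = L_x + D i_x]
    (lemma [ins_cediff], the only place where the sums over pairs of indices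
    have to be split). This gives [L_x D = D L_x] and then [D D = 0]; the operator
    [delta] on forms obeys the same rules as a Lie derivative, so both are
    instances of one operator [leib A B], and [delta D = D delta] comes from the
    same lemma [leib_cediff] as [L_x D = D L_x].

    The second components are governed by the operator
      [W_x = L_x i_x + i_(x^[2])]   ([squareop]),
    which lowers the degree by one: the second component of [d (phi, omega)] is
    [x |-> W_x phi + D (omega x)]. The map [x |-> W_x] is quadratic, with polar
    form
      [K_(x,y) = L_x i_y + L_y i_x + i_[x,y]]   ([polarop]),
    and Cartan's formula applied twice reads
    [i_y i_x D = K_(x,y) + D i_y i_x]; this is the compatibility between the two
    components of [d (phi, omega)]. Since [L_(x^[2]) = L_x L_x], one gets
    [W_x D = D W_x], hence [d d = 0]. Finally
    [delta W_x = W_x delta + K_(x, der x)]. The second component of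
    [delta (d (phi, omega))] contains [i_(der x) i_x D phi], which is
    [K_(x, der x) phi + D i_(der x) i_x phi]: its first term cancels the polar
    term above, and its second one is [D] applied to the term
    [phi (x, der x, ...)] of [delta_omega]. Hence [d delta = delta d].
    The square of [theta] is then [d d] in the first component and, up to
    [d d = 0], the sum [d delta + delta d = 0] in the second one. *)

(** * Substitution and deletion in tuples *)

Section Tuples.
Variable T : Type.

Lemma set_arg_cons0 n (x y : T) (z : n.-tuple T) :
  set_arg [tuple of x :: z] 0 y = [tuple of y :: z].
Proof.
apply: eq_from_tnth => j; rewrite tnth_mktuple.
by case: (unliftP ord0 j) => [k|] ->; rewrite ?tnthS.
Qed.

Lemma set_arg_consS n (x y : T) (z : n.-tuple T) i :
  set_arg [tuple of x :: z] (lift ord0 i) y = [tuple of x :: set_arg z i y].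
Proof.
apply: eq_from_tnth => j; rewrite tnth_mktuple.
case: (unliftP ord0 j) => [k|] -> //.
by rewrite !tnthS tnth_mktuple (inj_eq lift_inj).
Qed.

Lemma set_arg_id n (z : n.-tuple T) i : set_arg z i (tnth z i) = z.
Proof.
by apply: eq_from_tnth => j; rewrite tnth_mktuple; case: eqP => // ->.
Qed.

Lemma del_arg_cons0 n (x : T) (z : n.-tuple T) :
  del_arg [tuple of x :: z] 0 = z.
Proof. by apply: eq_from_tnth => j; rewrite tnth_mktuple tnthS. Qed.

Lemma del_arg_consS n (x : T) (z : n.+1.-tuple T) i :
  del_arg [tuple of x :: z] (lift ord0 i) = [tuple of x :: del_arg z i].
Proof.
apply: eq_from_tnth => j; rewrite tnth_mktuple.
case: (unliftP ord0 j) => [k|] ->; last first.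
  by rewrite (_ : lift _ _ = ord0) //; apply: val_inj.
rewrite (_ : lift _ (lift _ _) = lift ord0 (lift i k)) ?tnthS ?tnth_mktuple //.
by apply: val_inj; rewrite /= /bump /= !add1n ltnS addnS.
Qed.

Lemma del_arg2_cons0 n (x : T) (z : n.+1.-tuple T) j :
  del_arg2 [tuple of x :: z] ord0 (lift ord0 j) = del_arg z j.
Proof.
rewrite /del_arg2 del_arg_consS (_ : inord _ = 0) ?del_arg_cons0 //.
by apply: val_inj; rewrite /= inordK.
Qed.

Lemma del_arg2_consS n (x : T) (z : n.+2.-tuple T) (i j : 'I_n.+2) :
  (i < j)%N ->
  del_arg2 [tuple of x :: z] (lift ord0 i) (lift ord0 j)
    = [tuple of x :: del_arg2 z i j].
Proof.
move=> ltij; rewrite /del_arg2 del_arg_consS -(del_arg_consS x (del_arg z j)).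
congr (del_arg _ _).
have lti : (i < n.+1)%N by rewrite (leq_trans ltij) // -ltnS.
by apply: val_inj; rewrite /= !inordK // /bump /= add1n.
Qed.

End Tuples.

(** * Alternating forms and the insertion operator *)

Section Forms.
Variables (F : fieldType) (charF2 : 2%N \in [pchar F]).

(** Vector spaces over [F] have exponent 2. *)
Lemma addvv (W : lmodType F) (v : W) : v + v = 0.
Proof. by rewrite -mulr2n -scaler_nat (pcharf0 charF2) scale0r. Qed.

Lemma addvK (W : lmodType F) (v w : W) : v + (v + w) = w.
Proof. by rewrite addrA addvv add0r. Qed.

Lemma addv0_eq (W : lmodType F) (v w : W) : v + w = 0 -> v = w.
Proof. by move=> vw0; rewrite -[v]addr0 -vw0 addvK. Qed.

(** Proves an equality of sums in which every term occurs an even number of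
    times, both sides taken together: each term in turn is moved rightwards
    until it meets its copy. *)
Ltac char2 :=
  rewrite ?addr0 ?add0r;
  first [ reflexivity | apply: addv0_eq; rewrite -?addrA ?addvv ];
  repeat (match goal with
  | |- ?x + ?s = 0 =>
    repeat (first [ rewrite (addvK x) | rewrite (addvv x) ?addr0
                  | rewrite (addrCA x) ])
  end); try reflexivity.

Variables (g V : lmodType F).

(** Arbitrary [n]-ary functions, with their pointwise vector space structure. *)
Definition form n := n.-tuple g -> V.

(** Insertion (interior product) of [x] as first argument. *)
Definition ins n (x : g) (f : form n.+1) : form n := fun z => f [tuple of x :: z].

Lemma form_ext n (f h : form n.+1) : (forall x, ins x f = ins x h) -> f = h.
Proof.
by move=> E; apply/funext => z; case/tupleP: z => x z; have := congr1 (@^~ z) (E x).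
Qed.

Lemma insD n x (f h : form n.+1) : ins x (f + h : form n.+1) = ins x f + ins x h.
Proof. by []. Qed.

Lemma insZ n a x (f : form n.+1) : ins x (a *: f : form n.+1) = a *: ins x f.
Proof. by []. Qed.

Lemma ins0 n x : ins x (0 : form n.+1) = 0.
Proof. by []. Qed.

(** Alternating multilinear forms, defined by recursion on the degree: all the
    insertions are alternating, they depend linearly on the inserted vector, and
    [f (x, x, ...) = 0]; the condition [ohead z = Some x] is void when [z] is
    empty. The recursive form, equivalent to [alt_multilinear] by
    [alternatingE], makes proofs by insertion possible. *)
Fixpoint alternating n : form n -> Prop :=
  match n with
  | 0 => fun _ => True
  | m.+1 => fun f =>
     [/\ forall x, alternating (ins x f),
         linear (fun x => ins x f)
       & forall x (z : m.-tuple g), ohead z = Some x -> ins x f z = 0]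
  end.

Section AltTheory.
Variables (n : nat) (f : form n.+1) (altf : alternating f).

Lemma ins_alternating x : alternating (ins x f).
Proof. by case: altf => altx _ _; apply: altx. Qed.

Lemma ins_lin a x y : ins (a *: x + y) f = a *: ins x f + ins y f.
Proof. by case: altf => _ linf _; apply: linf. Qed.

Lemma ins_repeat x (z : n.-tuple g) : ohead z = Some x -> ins x f z = 0.
Proof. by case: altf => _ _ f0; apply: f0. Qed.

Lemma ins_add x y : ins (x + y) f = ins x f + ins y f.
Proof. by have := ins_lin 1 x y; rewrite !scale1r. Qed.

Lemma ins_0 : ins 0 f = 0.
Proof. by have := ins_add 0 0; rewrite addr0 addvv. Qed.

Lemma ins_scale a x : ins (a *: x) f = a *: ins x f.
Proof. by have := ins_lin a x 0; rewrite addr0 ins_0 addr0. Qed.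
End AltTheory.

Lemma ins_ins n (f : form n.+2) x : alternating f -> ins x (ins x f) = 0.
Proof. by case=> _ _ f0; apply/funext => z; apply: f0. Qed.

Lemma ins_swap n (f : form n.+2) x y :
  alternating f -> ins x (ins y f) = ins y (ins x f).
Proof.
move=> altf; have := ins_ins (x + y) altf.
rewrite (ins_add altf) !insD !(ins_add (ins_alternating altf _)) !ins_ins //.
by rewrite add0r addr0 => /addv0_eq.
Qed.

Lemma alternatingP n (f : form n.+2) :
  (forall x, alternating (ins x f)) -> linear (fun x => ins x f) ->
  (forall x, ins x (ins x f) = 0) -> alternating f.
Proof.
move=> f1 f2 f3; split=> // x z; case/tupleP: z => y z [->].
by have := congr1 (@^~ z) (f3 x).
Qed.

Lemma alternatingD n (f h : form n) :
  alternating f -> alternating h -> alternating (f + h).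
Proof.
elim: n f h => // n IHn f h altf alth; split.
- by move=> x; rewrite insD; apply: IHn; apply: ins_alternating.
- by move=> a x y; rewrite !insD (ins_lin altf) (ins_lin alth) scalerDr addrACA.
- move=> x z xz; rewrite insD [LHS](_ : _ = ins x f z + ins x h z) //.
  by rewrite (ins_repeat altf) // (ins_repeat alth) // addr0.
Qed.

(** In characteristic 2 an argument can be moved to the front without sign. *)
Lemma set_arg_front n (f : form n.+1) z i y :
  alternating f -> f (set_arg z i y) = f [tuple of y :: del_arg z i].
Proof.
elim: n f z i y => [|n IHn] f z i y altf; case/tupleP: z => x z.
all: case: (unliftP ord0 i) => [j|] ->; last by rewrite set_arg_cons0 del_arg_cons0.
  by case: j.
rewrite set_arg_consS del_arg_consS.
have := IHn _ z j y (ins_alternating altf x); rewrite {1}/ins => ->.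
exact: (congr1 (@^~ (del_arg z j)) (ins_swap y x altf)).
Qed.

Lemma alternatingE n (f : form n) : alternating f <-> alt_multilinear f.
Proof.
split; elim: n f => [|n IHn] f.
- by move=> _; split=> z [].
- move=> altf; split=> z i; case/tupleP: z => x z.
    case: (unliftP ord0 i) => [j|] -> a u v.
      by rewrite !set_arg_consS; apply: (IHn _ (ins_alternating altf x)).1.
    rewrite !set_arg_cons0.
    exact: (congr1 (@^~ z) (ins_lin altf a u v)).
  have f0 j : tnth z j = x -> f [tuple of x :: z] = 0.
    case: n f z j altf {IHn i} => [|n] f z j altf zj; first by case: j zj.
    rewrite -[z](set_arg_id z j) zj.
    have := set_arg_front z j x (ins_alternating altf x); rewrite {1}/ins => ->.
    exact: (congr1 (@^~ (del_arg z j)) (ins_ins x altf)).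
  move=> j; case: (unliftP ord0 i) (unliftP ord0 j) => [i'|] -> [j'|] -> //.
  - rewrite (inj_eq lift_inj) !tnthS => ij zij.
    exact: (IHn _ (ins_alternating altf x)).2 ij zij.
  - by rewrite tnthS tnth0 => _; apply: f0.
  - by rewrite tnthS tnth0 => _ /esym; apply: f0.
- by [].
- case=> fl f0; split.
  + move=> x; apply: IHn; split.
      move=> z i a u v; have := fl [tuple of x :: z] (lift ord0 i) a u v.
      by rewrite !set_arg_consS.
    move=> z i j ij zij; apply: (f0 _ (lift ord0 i) (lift ord0 j)).
      by rewrite (inj_eq lift_inj).
    by rewrite !tnthS.
  + move=> a u v; apply/funext => z.
    by have := fl [tuple of u :: z] ord0 a u v; rewrite !set_arg_cons0.
  + case: n f fl f0 {IHn} => [|n] f _ f0 x z; first by rewrite tuple0.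
    case/tupleP: z => y z [->].
    by apply: (f0 _ ord0 (lift ord0 ord0)); rewrite // tnthS !tnth0.
Qed.

(** * Leibniz operators: the common form of Lie derivatives and of [delta] *)

Fact leib_key : unit. Proof. by []. Qed.

(** [leib A B f (z_1, ..., z_n)] is
    [A (f (z_1, ..., z_n)) + \sum_i f (z_1, ..., B z_i, ..., z_n)]. It is
    locked so that unification does not see a pointwise sum of functions in
    it. *)
Definition leib n (A : V -> V) (B : g -> g) : form n -> form n :=
  locked_with leib_key (fun f z =>
    A (f z) + \sum_(i < n) f (set_arg z i (B (tnth z i)))).

Lemma leibE n A B (f : form n) z :
  leib A B f z = A (f z) + \sum_(i < n) f (set_arg z i (B (tnth z i))).
Proof. by rewrite /leib unlock. Qed.

Lemma leib0E A B (f : form 0) z : leib A B f z = A (f z).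
Proof. by rewrite leibE big_ord0 addr0. Qed.

Lemma ins_leib n A B y (f : form n.+1) :
  ins y (leib A B f) = leib A B (ins y f) + ins (B y) f.
Proof.
apply/funext => z; rewrite [RHS](_ : _ = leib A B (ins y f) z + ins (B y) f z) //.
rewrite /ins !leibE big_ord_recl set_arg_cons0 tnth0 -addrA; congr (_ + _).
rewrite addrC; congr (_ + _); apply: eq_bigr => i _.
by rewrite set_arg_consS tnthS.
Qed.

Lemma leibD n (A : {linear V -> V}) B (f h : form n) :
  leib A B (f + h) = leib A B f + leib A B h.
Proof.
apply/funext => z; rewrite [RHS](_ : _ = leib A B f z + leib A B h z) //.
by rewrite !leibE [(f + h) z](_ : _ = f z + h z) // linearD big_split addrACA.
Qed.

Lemma leibZ n (A : {linear V -> V}) B a (f : form n) :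
  leib A B (a *: f) = a *: leib A B f.
Proof.
apply/funext => z; rewrite [RHS](_ : _ = a *: leib A B f z) //.
by rewrite !leibE [(a *: f) z](_ : _ = a *: f z) // linearZ scalerDr scaler_sumr.
Qed.

Lemma leib0 n (A : {linear V -> V}) B : leib A B (0 : form n) = 0.
Proof. by rewrite -[X in leib _ _ X](scale0r 0) leibZ scale0r. Qed.

Lemma leib_alternating n (A : {linear V -> V}) B (f : form n) :
  linear B -> alternating f -> alternating (leib A B f).
Proof.
move=> linB; elim: n f => // -[|n] IHn f altf.
  split=> //; last by move=> x z; rewrite tuple0.
  move=> a x y; rewrite !ins_leib linB !(ins_lin altf) leibD leibZ.
  by rewrite scalerDr addrACA.
apply: alternatingP => [x|a x y|x].
- rewrite ins_leib; apply: alternatingD (ins_alternating altf _).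
  exact/IHn/ins_alternating.
- rewrite !ins_leib linB !(ins_lin altf) leibD leibZ.
  by rewrite scalerDr addrACA.
- rewrite ins_leib insD ins_leib ins_ins // leib0 (ins_swap x _ altf).
  by rewrite add0r addvv.
Qed.

(** The commutator of two Leibniz operators, which in characteristic 2 is also
    their anticommutator, is the Leibniz operator of the commutators. *)
Lemma leib_comm n (A A' : {linear V -> V}) A2 (B B' : g -> g) B2 (f : form n) :
  (forall v, A2 v = A (A' v) + A' (A v)) ->
  (forall y, B2 y = B (B' y) + B' (B y)) -> alternating f ->
  leib A B (leib A' B' f) + leib A' B' (leib A B f) = leib A2 B2 f.
Proof.
move=> EA EB; elim: n f => [|n IHn] f altf.
  apply/funext => z; rewrite leib0E EA.
  rewrite [LHS](_ : _ = leib A B (leib A' B' f) z + leib A' B' (leib A B f) z) //.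
  by rewrite !leib0E.
apply: form_ext => y; rewrite insD !ins_leib EB (ins_add altf).
rewrite -(IHn _ (ins_alternating altf y)) !leibD.
by char2.
Qed.

(** The terms of the square where [B] acts on two different arguments, or [A]
    and [B] act once each, occur twice and cancel. *)
Lemma leib_square n (A : {linear V -> V}) A2 (B : g -> g) B2 (f : form n) :
  (forall v, A2 v = A (A v)) -> (forall y, B2 y = B (B y)) ->
  leib A B (leib A B f) = leib A2 B2 f.
Proof.
move=> EA EB; elim: n f => [|n IHn] f.
  by apply/funext => z; rewrite !leib0E EA.
apply: form_ext => y; rewrite !ins_leib EB -IHn !leibD.
by char2.
Qed.

Lemma leib_lin n a A A' A2 (B B' : g -> g) B2 (f : form n) :
  (forall v, A2 v = a *: A v + A' v) ->
  (forall y, B2 y = a *: B y + B' y) -> alternating f ->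
  leib A2 B2 f = a *: leib A B f + leib A' B' f.
Proof.
move=> EA EB; elim: n f => [|n IHn] f altf.
  apply/funext => z; rewrite leib0E EA.
  rewrite [RHS](_ : _ = a *: leib A B f z + leib A' B' f z) //.
  by rewrite !leib0E.
apply: form_ext => y; rewrite insD insZ !ins_leib EB (ins_lin altf).
by rewrite (IHn _ (ins_alternating altf y)) scalerDr addrACA.
Qed.

(** * Lie derivatives and the Chevalley-Eilenberg differential *)

Section Operators.
Variables (L : resLieDer g) (R : restrictedRep L V).

Let linL x : linear (L x). Proof. exact: bracket_linear_r. Qed.

Let LDl a x y w : L (a *: x + y) w = a *: L x w + L y w.
Proof. exact: bracket_linear_l. Qed.

Let Lxx x : L x x = 0. Proof. exact: bracket_alt. Qed.

Let LC x y : L x y = L y x.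
Proof.
have := Lxx (x + y); have addL x' y' w : L (x' + y') w = L x' w + L y' w.
  by have := LDl 1 x' y' w; rewrite !scale1r.
have addR w x' y' : L w (x' + y') = L w x' + L w y'.
  by have := linL w 1 x' y'; rewrite !scale1r.
by rewrite addL !addR !Lxx add0r addr0 => /addv0_eq.
Qed.

(** Splits off the pairs whose first index is 0. *)
Lemma big_ltn_recl m (G : 'I_m.+1 -> 'I_m.+1 -> V) :
  \sum_(i < m.+1) \sum_(j < m.+1 | (i < j)%N) G i j =
  \sum_(j < m) G ord0 (lift ord0 j) +
  \sum_(i < m) \sum_(j < m | (i < j)%N) G (lift ord0 i) (lift ord0 j).
Proof.
rewrite big_ord_recl; congr (_ + _).
  by rewrite big_mkcond big_ord_recl /= add0r.
apply: eq_bigr => i _; rewrite big_mkcond big_ord_recl /= add0r [RHS]big_mkcond.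
by apply: eq_bigr.
Qed.

(** The Lie derivative along [x]. *)
Definition liederiv n (x : g) : form n -> form n := leib (R x) (L x).

Fact cediff_key : unit. Proof. by []. Qed.

(** The Chevalley-Eilenberg differential, which is [d_phi] in the degrees where
    the latter is defined; locked for the same reason as [leib]. *)
Definition cediff n : form n -> form n.+1 :=
  locked_with cediff_key (fun f z => act_sum R f z + bracket_sum L f z).

Lemma cediffE n (f : form n) z :
  cediff f z = act_sum R f z + bracket_sum L f z.
Proof. by rewrite /cediff unlock. Qed.

(** Cartan's formula in degree 0, where [cediff (ins x f)] does not exist. *)
Lemma ins_cediff0 (f : form 0) x : ins x (cediff f) = liederiv x f.
Proof.
apply/funext => z; rewrite /ins cediffE addr0 /act_sum big_ord_recl big_ord0.
by rewrite addr0 /liederiv leib0E tnth0 del_arg_cons0.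
Qed.

(** Cartan's formula [i_x D = L_x + D i_x]. *)
Lemma ins_cediff n (f : form n.+1) x : alternating f ->
  ins x (cediff f) = liederiv x f + cediff (ins x f).
Proof.
move=> altf; apply/funext => z.
rewrite [RHS](_ : _ = liederiv x f z + cediff (ins x f) z) //.
rewrite /ins /liederiv leibE !cediffE /act_sum.
rewrite big_ord_recl tnth0 del_arg_cons0 -!addrA.
congr (_ + _); rewrite addrCA; congr (_ + _).
  by apply: eq_bigr => i _; rewrite tnthS del_arg_consS.
(* The pairs [(0, j)] give the sum in the Lie derivative, the others give the
   bracket sum of [ins x f]. *)
rewrite /bracket_sum big_ltn_recl; congr (_ + _).
  apply: eq_bigr => i _.
  by rewrite (set_arg_front _ _ _ altf) tnthS del_arg2_cons0.
case: n f altf z => [|n] f altf z.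
  by rewrite big_ltn_recl !big_ord0 addr0.
apply: eq_bigr => i _; apply: eq_bigr => j ltij.
rewrite !tnthS del_arg2_consS //.
exact: (congr1 (@^~ (del_arg2 z i j)) (ins_swap _ _ altf)).
Qed.

Lemma cediffD n (f h : form n) : cediff (f + h) = cediff f + cediff h.
Proof.
apply/funext => z; rewrite [RHS](_ : _ = cediff f z + cediff h z) //.
rewrite !cediffE addrACA; congr (_ + _).
  rewrite /act_sum -big_split; apply: eq_bigr => i _ /=.
  by rewrite -linearD.
case: n f h z => [|n] f h z /=; first by rewrite addr0.
rewrite -big_split; apply: eq_bigr => i _ /=.
by rewrite -big_split.
Qed.

Lemma cediffZ n a (f : form n) : cediff (a *: f) = a *: cediff f.
Proof.
apply/funext => z; rewrite [RHS](_ : _ = a *: cediff f z) //.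
rewrite !cediffE scalerDr; congr (_ + _).
  rewrite /act_sum scaler_sumr; apply: eq_bigr => i _ /=.
  by rewrite -linearZ.
case: n f z => [|n] f z /=; first by rewrite scaler0.
rewrite scaler_sumr; apply: eq_bigr => i _ /=.
by rewrite scaler_sumr.
Qed.

Lemma cediff0 n : cediff (0 : form n) = 0.
Proof. by rewrite -[X in cediff X](scale0r 0) cediffZ scale0r. Qed.

Lemma liederiv_alternating n x (f : form n) :
  alternating f -> alternating (liederiv x f).
Proof. exact: leib_alternating. Qed.

Lemma liederiv_lin n a x y (f : form n) : alternating f ->
  liederiv (a *: x + y) f = a *: liederiv x f + liederiv y f.
Proof.
move=> altf; apply: leib_lin => // v.
exact: (rho_linear R v a x y).
Qed.

Lemma liederiv_add n x y (f : form n) : alternating f ->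
  liederiv (x + y) f = liederiv x f + liederiv y f.
Proof. by move=> /(liederiv_lin 1 x y); rewrite !scale1r. Qed.

Lemma liederiv_scale n a x (f : form n) : alternating f ->
  liederiv (a *: x) f = a *: liederiv x f.
Proof.
move=> altf; have L0 : liederiv 0 f = 0.
  by have := liederiv_add 0 0 altf; rewrite addr0 addvv.
by have := liederiv_lin a x 0 altf; rewrite addr0 L0 addr0.
Qed.

Lemma ins_liederiv n x y (f : form n.+1) :
  ins y (liederiv x f) = liederiv x (ins y f) + ins (L x y) f.
Proof. exact: ins_leib. Qed.

Lemma liederivD n x (f h : form n) : liederiv x (f + h) = liederiv x f + liederiv x h.
Proof. exact: leibD. Qed.

Lemma liederivZ n x a (f : form n) : liederiv x (a *: f) = a *: liederiv x f.
Proof. exact: leibZ. Qed.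

Lemma cediff_alternating n (f : form n) : alternating f -> alternating (cediff f).
Proof.
elim: n f => [|n IHn] f altf.
  split=> // [a x y|x z]; last by rewrite tuple0.
  by rewrite !ins_cediff0 liederiv_lin.
apply: alternatingP => [x|a x y|x].
- rewrite ins_cediff //; apply: alternatingD; first exact: liederiv_alternating.
  exact/IHn/ins_alternating.
- rewrite !ins_cediff // liederiv_lin // (ins_lin altf) cediffD cediffZ.
  by rewrite scalerDr addrACA.
- rewrite ins_cediff // insD ins_liederiv Lxx (ins_0 altf) addr0.
  case: n f altf {IHn} => [|n] f altf.
    by rewrite ins_cediff0 addvv.
  rewrite ins_cediff; last exact: ins_alternating.
  by rewrite ins_ins // cediff0 addr0 addvv.
Qed.

(** Leibniz operators built from compatible derivations commute with the
    differential. *)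
Lemma leib_cediff n (A : {linear V -> V}) B (f : form n) : linear B ->
  (forall x y, B (L x y) = L (B x) y + L x (B y)) ->
  (forall x v, A (R x v) = R (B x) v + R x (A v)) ->
  alternating f -> leib A B (cediff f) = cediff (leib A B f).
Proof.
move=> linB derB derA.
have comm m x (h : form m) : alternating h ->
    leib A B (liederiv x h) + liederiv x (leib A B h) = liederiv (B x) h.
  move=> alth; apply: leib_comm => // [v|y].
    by rewrite derA -addrA addvv addr0.
  by rewrite derB -addrA addvv addr0.
elim: n f => [|n IHn] f altf; apply: form_ext => x; rewrite ins_leib.
  by rewrite !ins_cediff0 -(comm _ x f) //; char2.
have altLf := leib_alternating A linB altf.
rewrite !ins_cediff // leibD (IHn _ (ins_alternating altf x)) ins_leib.
rewrite cediffD -(comm _ x f) //; char2.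
Qed.

Lemma R_bracket x y v : R (L x y) v = R x (R y v) + R y (R x v).
Proof.
by rewrite rho_bracket; congr (_ + _); apply: addv0_eq; rewrite addNr.
Qed.

Lemma L_jacobi x y z : L x (L y z) = L (L x y) z + L y (L x z).
Proof.
apply: addv0_eq; have := bracket_jacobi L x y z.
by rewrite -addrA (LC z x) (LC z (L x y)) [L y _ + _]addrC.
Qed.

Lemma liederiv_cediff n x (f : form n) : alternating f ->
  liederiv x (cediff f) = cediff (liederiv x f).
Proof.
apply: leib_cediff => // [y z|y v]; first exact: L_jacobi.
by rewrite R_bracket -addrA addvv addr0.
Qed.

Lemma cediff_cediff n (f : form n) : alternating f -> cediff (cediff f) = 0.
Proof.
elim: n f => [|n IHn] f altf; apply: form_ext => x;
  rewrite ins_cediff ?ins0; try exact: cediff_alternating.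
  by rewrite ins_cediff0 liederiv_cediff // addvv.
rewrite ins_cediff // cediffD IHn; last exact: ins_alternating.
by rewrite addr0 liederiv_cediff // addvv.
Qed.

Lemma liederiv_sq n x (f : form n) :
  liederiv (sq L x) f = liederiv x (liederiv x f).
Proof.
symmetry; apply: leib_square => [v|y]; first exact: rho_sq.
exact: sq_bracket.
Qed.

(** * The quadratic operator and its polar form *)

(** The part of [d_omega] that depends on the first component of a cochain. *)
Definition squareop n (x : g) (phi : form n.+1) : form n :=
  liederiv x (ins x phi) + ins (sq L x) phi.

(** The polar form of the quadratic map [x |-> squareop x]. *)
Definition polarop n (x y : g) (phi : form n.+1) : form n :=
  liederiv x (ins y phi) + liederiv y (ins x phi) + ins (L x y) phi.

Lemma squareopD n x (f h : form n.+1) :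
  squareop x (f + h) = squareop x f + squareop x h.
Proof. by rewrite /squareop !insD liederivD addrACA. Qed.

Lemma squareop_scale n a x (f : form n.+1) : alternating f ->
  squareop (a *: x) f = a ^+ 2 *: squareop x f.
Proof.
move=> altf; rewrite /squareop sqZ !(ins_scale altf) liederivZ.
by rewrite liederiv_scale ?scalerA ?scalerDr //; apply: ins_alternating.
Qed.

Lemma squareop_add n x y (f : form n.+1) : alternating f ->
  squareop (x + y) f = squareop x f + squareop y f + polarop x y f.
Proof.
move=> altf; have altx := ins_alternating altf.
rewrite /squareop /polarop sqD !(ins_add altf) !liederivD !liederiv_add //.
char2.
Qed.

Lemma squareop_alternating n x (f : form n.+1) :
  alternating f -> alternating (squareop x f).
Proof.
move=> altf; have altx := ins_alternating altf.
by apply: alternatingD => //; apply: liederiv_alternating.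
Qed.

(** The operators [squareop x] and [cediff] commute, because
    [L_(x^[2]) = L_x L_x]. *)
Lemma squareop_cediff n x (f : form n.+1) : alternating f ->
  squareop x (cediff f) + cediff (squareop x f) = 0.
Proof.
move=> altf; have altx := ins_alternating altf.
rewrite /squareop !ins_cediff // cediffD liederivD !liederiv_cediff //.
rewrite liederiv_sq; char2.
Qed.

(** Cartan's formula applied twice, in degree 1 and above. *)
Lemma ins2_cediff1 x y (f : form 1) : alternating f ->
  ins y (ins x (cediff f)) = polarop x y f.
Proof.
move=> altf; rewrite ins_cediff // insD ins_liederiv ins_cediff0 /polarop.
by rewrite addrAC.
Qed.

Lemma ins2_cediff n x y (f : form n.+2) : alternating f ->
  ins y (ins x (cediff f)) = polarop x y f + cediff (ins y (ins x f)).
Proof.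
move=> altf; have altx := ins_alternating altf.
rewrite ins_cediff // insD ins_liederiv ins_cediff // /polarop.
char2.
Qed.

(** The operator [delta] on forms, i.e. [delta_phi] written as a Leibniz
    operator. *)
Definition derform n : form n -> form n := leib (eta R) (der L).

Lemma derformE n (f : form n) : derform f = delta_phi R f.
Proof. by apply/funext => z; rewrite /derform leibE. Qed.

Lemma derformD n (f h : form n) : derform (f + h) = derform f + derform h.
Proof. exact: leibD. Qed.

Lemma derformZ n a (f : form n) : derform (a *: f) = a *: derform f.
Proof. exact: leibZ. Qed.

Lemma ins_derform n x (f : form n.+1) :
  ins x (derform f) = derform (ins x f) + ins (der L x) f.
Proof. exact: ins_leib. Qed.

Lemma derform_alternating n (f : form n) :
  alternating f -> alternating (derform f).
Proof. by apply: leib_alternating; apply: linearP. Qed.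

Lemma derform_cediff n (f : form n) :
  alternating f -> derform (cediff f) = cediff (derform f).
Proof.
apply: leib_cediff; [exact: linearP|exact: der_bracket|exact: rho_der].
Qed.

(** The defect of commutation of [delta] with [squareop x] is a polar term. *)
Lemma derform_squareop n x (f : form n.+1) : alternating f ->
  derform (squareop x f) = squareop x (derform f) + polarop x (der L x) f.
Proof.
move=> altf; have altx := ins_alternating altf.
have comm : derform (liederiv x (ins x f)) + liederiv x (derform (ins x f))
          = liederiv (der L x) (ins x f).
  apply: leib_comm => // [v|y].
    by rewrite rho_der -addrA addvv addr0.
  by rewrite der_bracket -addrA addvv addr0.
rewrite /squareop /polarop derformD -comm !ins_derform liederivD der_sq.
char2.
Qed.

(** * The operators on cochains *)

Lemma is_cochainP m (phi : form m.+2) (omega : g -> form m) :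
  is_cochain ((phi, omega) : precochain g V m.+1) <->
  [/\ alternating phi, forall x, alternating (omega x),
      forall a x, omega (a *: x) = a ^+ 2 *: omega x
    & forall x y, omega (x + y) = omega x + omega y + ins y (ins x phi)].
Proof.
split=> -[altphi altomega omegaZ omegaD]; split.
- exact/alternatingE.
- by move=> x; apply/alternatingE.
- by move=> a x; apply/funext => z; apply: omegaZ.
- by move=> x y; apply/funext => z; apply: omegaD.
- exact/alternatingE.
- by move=> x; apply/alternatingE.
- by move=> a x z; rewrite omegaZ.
- by move=> x y z; rewrite omegaD.
Qed.

(** A cochain of degree 1 seen as a form on 1-tuples, which makes the degree 1
    operators instances of the general ones. *)
Definition form1 (phi : g -> V) : form 1 := fun z => phi (thead z).

Lemma form1_alternating (phi : g -> V) : linear phi -> alternating (form1 phi).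
Proof.
move=> linphi; split=> // [a x y|x z]; last by rewrite tuple0.
by apply/funext => z; apply: linphi.
Qed.

Lemma d0E (phi : g -> V) : linear phi ->
  d R (phi : precochain g V 0) =
  (cediff (form1 phi), fun x => squareop x (form1 phi)).
Proof.
move=> linphi; have altphi := form1_alternating linphi; congr pair.
  apply/funext => z; case/tupleP: z => x z; case/tupleP: z => y z.
  rewrite -[RHS](_ : ins y (ins x (cediff (form1 phi))) z = _) //.
  (* In degree 1 the differential at [(x, y)] is the polar term alone. *)
  rewrite ins2_cediff1 //.
  rewrite [RHS](_ : _ = liederiv x (ins y (form1 phi)) z
    + liederiv y (ins x (form1 phi)) z + ins (L x y) (form1 phi) z) //.
  by rewrite /liederiv !leib0E addrC addrA.
apply/funext => x; apply/funext => z.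
rewrite [RHS](_ : _ = liederiv x (ins x (form1 phi)) z
  + ins (sq L x) (form1 phi) z) //.
by rewrite /liederiv leib0E addrC.
Qed.

Lemma dSE m (phi : form m.+2) (omega : g -> form m) : alternating phi ->
  d R ((phi, omega) : precochain g V m.+1) =
  (cediff phi, fun x => squareop x phi + cediff (omega x)).
Proof.
move=> altphi; congr pair; first by apply/funext => z; rewrite cediffE.
apply/funext => x; apply/funext => z.
rewrite [RHS](_ : _ = liederiv x (ins x phi) z + ins (sq L x) phi z
  + cediff (omega x) z) // /liederiv leibE cediffE /d_omega !addrA.
congr (_ + _ + _); rewrite addrAC; congr (_ + _ + _).
apply: eq_bigr => i _; rewrite set_arg_front; last exact: ins_alternating.
exact: (congr1 (@^~ (del_arg z i)) (ins_swap _ _ altphi)).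
Qed.

Lemma form1_delta (phi : g -> V) : form1 (delta1 R phi) = derform (form1 phi).
Proof.
apply: form_ext => x; rewrite ins_leib; apply/funext => z.
rewrite [RHS](_ : _ = derform (ins x (form1 phi)) z + ins (der L x) (form1 phi) z) //.
by rewrite /derform leib0E.
Qed.

Lemma deltaSE m (phi : form m.+2) (omega : g -> form m) :
  delta R ((phi, omega) : precochain g V m.+1) =
  (derform phi, fun x => derform (omega x) + ins (der L x) (ins x phi)).
Proof.
congr pair; first by rewrite derformE.
by apply/funext => x; rewrite derformE.
Qed.

Lemma cochainD k (c c' : precochain g V k) :
  is_cochain c -> is_cochain c' -> is_cochain (c + c').
Proof.
case: k c c' => [|m] c c'.
  move=> linc linc' a x y; rewrite [LHS](_ : _ = c (a *: x + y) + c' (a *: x + y)) //.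
  by rewrite linc linc' addrACA -scalerDr.
case: c c' => phi omega [phi' omega'] /is_cochainP[p o oZ oD].
move=> /is_cochainP[p' o' oZ' oD'].
apply/is_cochainP; split.
- exact: alternatingD.
- by move=> x; apply: alternatingD.
- move=> a x; rewrite [LHS](_ : _ = omega (a *: x) + omega' (a *: x)) //.
  by rewrite oZ oZ' -scalerDr.
- move=> x y; rewrite [LHS](_ : _ = omega (x + y) + omega' (x + y)) //.
  by rewrite oD oD' !insD addrACA; congr (_ + _); rewrite addrACA.
Qed.

Lemma dD k (c c' : precochain g V k) : is_cochain c -> is_cochain c' ->
  d R (c + c') = d R c + d R c'.
Proof.
case: k c c' => [|m] c c'.
  move=> linc linc'; rewrite !d0E //; last exact: (@cochainD 0).
  rewrite (_ : form1 _ = form1 c + form1 c') //.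
  rewrite cediffD; congr pair; apply/funext => x; exact: squareopD.
case: c c' => phi omega [phi' omega'] /is_cochainP[altphi _ _ _].
move=> /is_cochainP[altphi' _ _ _].
rewrite !dSE //; last exact: alternatingD.
rewrite cediffD; congr pair; apply/funext => x.
by rewrite cediffD squareopD addrACA.
Qed.

Lemma d_cochain k (c : precochain g V k) : is_cochain c -> is_cochain (d R c).
Proof.
case: k c => [|m] =>
  [c linc|[phi omega] /is_cochainP[altphi altomega omegaZ omegaD]].
  have altc := form1_alternating linc; rewrite d0E //; apply/is_cochainP; split.
  - exact: cediff_alternating.
  - by move=> x; apply: squareop_alternating.
  - by move=> a x; apply: squareop_scale.
  - by move=> x y; rewrite squareop_add // ins2_cediff1.
rewrite dSE //; apply/is_cochainP; split.
- exact: cediff_alternating.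
- move=> x; apply: alternatingD; first exact: squareop_alternating.
  exact: cediff_alternating.
- by move=> a x; rewrite squareop_scale // omegaZ cediffZ [RHS]scalerDr.
- move=> x y; rewrite squareop_add // omegaD !cediffD ins2_cediff //.
  char2.
Qed.

Lemma delta_cochain k (c : precochain g V k) :
  is_cochain c -> is_cochain (delta R c).
Proof.
have linD : linear (der L) by apply: linearP.
case: k c => [|m] =>
  [c linc a x y|[phi omega] /is_cochainP[altphi altomega omegaZ omegaD]].
  by rewrite /= /delta1 !linc !linearP linc scalerDr addrACA.
have altx := ins_alternating altphi.
rewrite deltaSE; apply/is_cochainP; split.
- exact: derform_alternating.
- move=> x; apply: alternatingD; first exact: derform_alternating.
  exact: ins_alternating.
- move=> a x; rewrite omegaZ linearZ /= (ins_scale altphi) insZ.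
  by rewrite (ins_scale (altx x)) scalerA [RHS]scalerDr derformZ.
- move=> x y; rewrite omegaD linearD /= (ins_add altphi).
  rewrite insD !(ins_add (altx _)).
  rewrite !derformD !ins_derform !insD !ins_derform.
  rewrite (ins_swap (der L x) y altphi).
  char2.
Qed.

Lemma d_d k (c : precochain g V k) : is_cochain c -> d R (d R c) = 0.
Proof.
case: k c => [|m] =>
  [c linc|[phi omega] /is_cochainP[altphi altomega omegaZ omegaD]].
  have altc := form1_alternating linc; rewrite d0E // dSE;
    last exact: cediff_alternating.
  rewrite cediff_cediff //; congr pair; apply/funext => x.
  exact: squareop_cediff.
rewrite (dSE omega altphi) dSE; last exact: cediff_alternating.
rewrite cediff_cediff //; congr pair; apply/funext => x.
by rewrite cediffD addrA squareop_cediff // cediff_cediff // addr0.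
Qed.

Lemma d_delta k (c : precochain g V k) :
  is_cochain c -> d R (delta R c) = delta R (d R c).
Proof.
case: k c => [|m] =>
  [c linc|[phi omega] /is_cochainP[altphi altomega omegaZ omegaD]].
  have altc := form1_alternating linc; rewrite !d0E //;
    last exact: (@delta_cochain 0).
  rewrite deltaSE form1_delta.
  rewrite derform_cediff //; congr pair; apply/funext => x.
  by rewrite derform_squareop // ins2_cediff1 // -addrA addvv addr0.
have altx := ins_alternating altphi.
rewrite deltaSE (dSE omega altphi) dSE; last exact: derform_alternating.
rewrite deltaSE derform_cediff //; congr pair; apply/funext => x.
rewrite ins2_cediff // derformD derform_squareop //.
rewrite derform_cediff // cediffD.
char2.
Qed.

End Operators.

End Forms.

Theorem theorem3p3 (F : fieldType) (charF2 : 2%N \in [pchar F])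
    (g : lmodType F) (L : resLieDer g)
    (V : lmodType F) (R : restrictedRep L V)
    (k : nat) (c : precochain_ResLD g V k) (hc : is_cochain_ResLD c) :
  is_cochain_ResLD (theta R c) /\ theta R (theta R c) = 0.
Proof.
case: k c hc => [|m] c hc.
  split; first by split; [apply: d_cochain | apply: delta_cochain].
  apply: (congr2 pair); first exact: d_d.
  rewrite -[LHS]/(d R (delta R (c : precochain g V 0)) + delta R (d R c)).
  by rewrite d_delta // addvv.
have [hc1 hc2] : is_cochain c.1 /\ is_cochain c.2 := hc.
have dc1 := d_cochain charF2 R hc1; have dc2 := d_cochain charF2 R hc2.
have deltac1 := delta_cochain charF2 R hc1.
split; first by split; [exact: dc1 | exact: cochainD].
apply: (congr2 pair); first exact: d_d.
rewrite -[LHS]/(d R (d R c.2 + delta R c.1) + delta R (d R c.1)).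
by rewrite dD // d_d // add0r d_delta // addvv.
Qed.
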